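(* Let $n,k$ be positive integers such that $k\equiv 0\pmod 6$, $k\geq 12$, $(n-2)\equiv 0\pmod{k-2}$ and $(n-1)(n-2)\equiv 2(k-2)\pmod{(k-1)(k-2)}$. Then $$D(n,k,3)\leq J'(n,k,3)-\left\lfloor\frac{n}{3k^3}\right\rfloor.$$
   Context: For integers $n\geq k\geq 3$, a $3$-$(n,k,1)$ packing is a pair $(X,\mathcal{B})$ where $X$ is an $n$-set and $\mathcal{B}$ is a collection of $k$-subsets of $X$ (blocks) such that every $3$-subset of $X$ is contained in at most one block. $D(n,k,3)$ denotes the maximum number of blocks in a $3$-$(n,k,1)$ packing (standing assumption: $n\geq k$). Define $$J'(n,k,3)=\left\lfloor\frac{n}{k}\left(\left\lfloor\frac{(n-1)(n-2)}{(k-1)(k-2)}\right\rfloor-1\right)\right\rfloor.$$ *)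

(* Defs.v *)
From mathcomp Require Import all_boot all_order all_algebra.

Set Implicit Arguments.
Unset Strict Implicit.
Unset Printing Implicit Defensive.

Import Order.TTheory GRing.Theory Num.Theory.

(* (X, B) is a 3-(#|X|, k, 1) packing; B is a set, so blocks are not repeated. *)
Definition packing3 (X : finType) (k : nat) (B : {set {set X}}) : bool :=
  [forall b in B, #|b| == k] &&
  [forall S : {set X}, (#|S| == 3) ==> (#|[set b in B | S \subset b]| <= 1)].

(* D(n, k, 3); the empty packing makes the maximum nonvacuous. *)
Definition D3 (n k : nat) : nat :=
  \max_(B : {set {set 'I_n}} | packing3 k B) #|B|.

Local Open Scope ring_scope.

(* J'(n, k, 3), with all arithmetic in the rationals, so that no subtraction
   or division is truncated. *)
Definition J3' (n k : nat) : int :=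
  let N : rat := n%:R in
  let K : rat := k%:R in
  Num.floor (N / K *
    ((Num.floor ((N - 1) * (N - 2) / ((K - 1) * (K - 2))))%:~R - 1)).

(* Main.v *)
Require Import Defs.
From mathcomp Require Import all_boot all_order all_algebra.
From mathcomp Require Import all_fingroup all_solvable zify lra.

(** Write [n - 2 = (k - 2) t] and [(n - 1) t = R (k - 1) + 2].  A pair [xy] lying in [t - m] blocks
    lies in exactly [(k - 2) m] uncovered triples, and for fixed [x] these defects [m] sum to
    [2 + (k - 1) (R - r_x)], with [r_x] the degree of [x].  One deficient pair [xy] already makes
    the sum at least [k - 1], whence [r_x <= R - 1].  When [r_x = R - 1], [x] has exactly [k + 1]
    neighbours in the graph of deficient pairs, all with defect 1.  If that held at all points
    within distance 2 of [x], these points would form a component [C] with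
    [k + 2 <= #|C| <= k + 5]; counting edges gives [2 %| #|C|], and counting uncovered triples
    gives [3 %| #|C|], which is impossible when [6 %| k].  So every point is within distance 2 of a
    point with [r_x < R - 1], and such points are numerous: [n <= 3 k^2 \sum_x (R - 1 - r_x)]. *)

Set Implicit Arguments.
Unset Strict Implicit.
Unset Printing Implicit Defensive.

(** * Fixed-point-free maps of prime order *)

(** [f] generates a cyclic [p]-group acting on [A], so [#|A|] is congruent modulo [p] to its number
    of fixed points, here 0. Swaps ([p = 2]) and rotations ([p = 3]) give the two divisibility
    counts below. *)
Lemma dvdn_card_free (T : finType) (f : T -> T) (p : nat) (A : {set T}) :
    prime p -> (forall x, iter p f x = x) ->
    {in A, forall x, f x \in A} -> {in A, forall x, f x != x} ->
  p %| #|A|.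
Proof.
move=> p_pr fp fA fix_f.
have f_inj : injective f.
  apply: (@can_inj _ _ _ (iter p.-1 f)) => x.
  by rewrite -iterSr prednK ?prime_gt0.
pose g := perm f_inj.
have gE m x : (g ^+ m)%g x = iter m f x by rewrite permX; apply: eq_iter => y; rewrite permE.
have pG : (p.-group <[g]>)%g.
  rewrite /pgroup -orderE (pnat_dvd _ (pnat_id p_pr)) //.
  by rewrite order_dvdn; apply/eqP/permP=> x; rewrite gE fp perm1.
have actA : [acts <[g]>%g, on A | 'P]%g.
  rewrite cycle_subG; apply/astabsP => x; rewrite /= apermE permE.
  apply/idP/idP => [fxA|/fA//].
  have it m y : y \in A -> iter m f y \in A by move=> yA; elim: m => //= m /fA.
  by rewrite -(fp x) -(prednK (prime_gt0 p_pr)) iterSr it.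
have := pgroup_fix_mod pG actA.
rewrite (_ : ('Fix_(A | 'P)(<[g]>))%g = set0) ?cards0 ?mod0n ?/dvdn => [->//|].
apply/setP => x; rewrite in_set0 inE; apply/negbTE/negP => /andP[xA].
move/afixP => /(_ g (cycle_id g)) /=; rewrite apermE permE => /eqP.
by rewrite (negbTE (fix_f x xA)).
Qed.

(** * Components of graphs whose edges lie in many triangles *)

Section Graph.
Variables (X : finType) (G : rel X).
Hypotheses (G_sym : symmetric G) (G_irr : irreflexive G).
Local Notation nb x := [set y | G x y].

(** Swapping the ends is a free involution on the ordered edges starting in [C]. *)
Lemma even_degree_sum (C : {set X}) (d : nat) :
    {in C, forall x, nb x \subset C} -> {in C, forall x, #|nb x| = d} ->
  2 %| #|C| * d.
Proof.
move=> Ccl Cd.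
pose P := [set p : X * X | (p.1 \in C) && G p.1 p.2].
suff <- : #|P| = #|C| * d.
  apply: (@dvdn_card_free _ (fun p => (p.2, p.1))) => //.
  - by case.
  - move=> [x y]; rewrite !inE /= => /andP[xC xy]; rewrite G_sym xy andbT.
    by apply: (subsetP (Ccl x xC)); rewrite inE.
  - move=> [x y]; rewrite !inE /= => /andP[_ xy]; apply/negP => /eqP[e _].
    by rewrite e G_irr in xy.
rewrite -sum_nat_const -sum1_card (eq_bigl (fun p => (p.1 \in C) && G p.1 p.2));
  last by move=> p; rewrite inE.
rewrite -(pair_big_dep (mem C) (fun x y => G x y) (fun _ _ => 1)) /=.
by apply: eq_bigr => x xC; rewrite -(Cd x xC) -sum1_card; apply: eq_bigl => y; rewrite inE.
Qed.

(* The edges leaving [nb x] are at most [2 (k + 1)], and a vertex at distance 2 absorbs at least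
   [k - 4] of them, so at most 3 vertices are at distance 2, and none further away. *)
Lemma small_component (k : nat) (x : X)
    (Z := [set z | (z != x) && ~~ G x z && [exists y, G x y && G y z]])
    (C := x |: nb x :|: Z) :
    12 <= k ->
    (forall y z, G y z -> k - 2 <= #|nb y :&: nb z|) ->
    {in C, forall y, #|nb y| = k.+1} ->
  {in C, forall y, nb y \subset C} /\ k + 2 <= #|C| <= k + 5.
Proof.
move=> k12 comm degC.
have xC : x \in C by rewrite !inE eqxx.
have nbC y : G x y -> y \in C by rewrite !inE => ->; rewrite orbT.
have ZC z : z \in Z -> z \in C by rewrite [_ \in C]inE => ->; rewrite orbT.
(* Among the [k + 1] neighbours of [y], the point [x] and at least [k - 2] common neighbours lie in
   [x |: nb x]. *)
have out y : G x y -> #|nb y :\: (x |: nb x)| <= 2.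
  move=> xy; have := cardsID (x |: nb x) (nb y); rewrite (degC y) ?nbC //.
  have : #|x |: (nb x :&: nb y)| <= #|nb y :&: (x |: nb x)|.
    apply: subset_leq_card; apply/subsetP=> z; rewrite !inE.
    by case/orP => [/eqP->|/andP[-> ->]]; rewrite ?eqxx ?orbT // G_sym xy.
  rewrite cardsU1 !inE G_irr /=; have := comm _ _ xy; lia.
(* Through a middle point [y], at least [k - 2] common neighbours of [y] and [z]; by [out], all but
   2 of them lie in [nb x]. *)
have inn z : z \in Z -> k - 4 <= #|nb z :&: nb x|.
  rewrite inE => /andP[/andP[zx xz] /existsP[y /andP[xy yz]]].
  have := comm _ _ yz; have := out _ xy.
  have : #|nb y :&: nb z| <= #|(nb z :&: nb x) :|: (nb y :\: (x |: nb x))|.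
    apply: subset_leq_card; apply/subsetP=> w; rewrite !inE => /andP[yw zw].
    rewrite yw zw /= andbT; case: eqP => [e|_]; last by rewrite orbN.
    by move: zw; rewrite e G_sym (negbTE xz).
  have [+ _] := leq_card_setU (nb z :&: nb x) (nb y :\: (x |: nb x)); lia.
(* Double counting the edges between [Z] and [nb x] gives [#|Z| (k - 4) <= 2 (k + 1)], and
   [4 (k - 4) > 2 (k + 1)] once [k > 9]. *)
have Z3 : #|Z| <= 3.
  have : #|Z| * (k - 4) <= #|nb x| * 2.
    rewrite -!sum_nat_const; apply: (leq_trans (leq_sum _ inn)).
    under eq_bigr do rewrite -sum1_card.
    rewrite (exchange_big_dep (mem (nb x))) /=; last by move=> z y _ /setIP[].
    apply: leq_sum => y; rewrite inE => xy.
    rewrite sum1_card; apply: leq_trans (out y xy); apply: subset_leq_card.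
    apply/subsetP => z; rewrite unfold_in /= => /andP[zZ]; rewrite !inE => /andP[zy _].
    by move: zZ; rewrite inE => /andP[/andP[/negbTE-> /negbTE->] _]; rewrite G_sym.
  rewrite (degC x xC); nia.
split.
  move=> y; rewrite !inE -!orbA => /or3P[/eqP->|xy|yZ]; apply/subsetP => w; rewrite inE => yw.
  - exact: nbC.
  - rewrite !inE; case: eqP => //= _; case: (boolP (G x w)) => //= _.
    by apply/existsP; exists y; rewrite xy.
  - have {}yZ : y \in Z by rewrite inE.
    (* A neighbour [w] of [y] outside [C] has no neighbour in [nb x], so its common neighbours with
       [y] lie in [nb y :\: nb x], of size at most 5, less than [k - 2]. *)
    apply/negPn/negP => wC.
    have := comm _ _ yw; have := inn _ yZ; have := cardsID (nb x) (nb y).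
    rewrite (degC y (ZC y yZ)).
    have : #|nb y :&: nb w| <= #|nb y :\: nb x|.
      apply: subset_leq_card; apply/subsetP=> v; rewrite !inE => /andP[yv wv].
      rewrite yv andbT; apply/negP => xv; case/negP: wC; rewrite !inE.
      case: eqP => //= _; case: (boolP (G x w)) => //= _.
      by apply/existsP; exists v; rewrite xv G_sym.
    lia.
rewrite cardsU (_ : _ :&: Z = set0) ?cards0.
  rewrite cardsU1 inE G_irr (degC x xC); lia.
by apply/setP=> w; rewrite !inE; case: eqP; case: (G x w); rewrite //= ?andbF.
Qed.
End Graph.

(** Rotation acts on the ordered triples starting in [C]; a fixed triple would have equal
    entries. *)
Lemma dvdn3_triple_sum (X : finType) (T : X -> X -> X -> bool) (C : {set X}) :
    (forall x y z, T x y z -> T y z x) -> (forall x y z, T x y z -> x != y) ->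
    (forall x y z, x \in C -> T x y z -> y \in C) ->
  3 %| \sum_(x in C) \sum_y #|[set z | T x y z]|.
Proof.
move=> rotT neqT clT.
pose P := [set p : X * X * X | (p.1.1 \in C) && T p.1.1 p.1.2 p.2].
suff <- : #|P| = \sum_(x in C) \sum_y #|[set z | T x y z]|.
  apply: (@dvdn_card_free _ (fun p => (p.1.2, p.2, p.1.1))) => //.
  - by do 2!case.
  - move=> [[x y] z]; rewrite !inE /= => /andP[xC t].
    by rewrite (clT _ _ _ xC t) rotT.
  - move=> [[x y] z]; rewrite !inE /= => /andP[_ t]; apply/negP => /eqP[e _ _].
    by have := neqT _ _ _ t; rewrite e eqxx.
rewrite -sum1_card (eq_bigl (fun p : X * X * X => (p.1.1 \in C) && T p.1.1 p.1.2 p.2));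
  last by move=> p; rewrite inE.
rewrite -(pair_big_dep (fun q : X * X => q.1 \in C) (fun q z => T q.1 q.2 z) (fun _ _ => 1)) /=.
rewrite (eq_bigl (fun q : X * X => (q.1 \in C) && true)); last by move=> q; rewrite andbT.
rewrite -(pair_big_dep (mem C) (fun _ _ => true) (fun x y => \sum_(z | T x y z) 1)) /=.
apply: eq_bigr => x _; apply: eq_bigr => y _; rewrite -sum1_card.
by apply: eq_bigl => z; rewrite inE.
Qed.

(** * Uncovered triples and defects of pairs *)

Section Packing.
Variables (X : finType) (k t : nat) (B : {set {set X}}).
Hypotheses (packB : packing3 k B) (k_ge12 : 12 <= k) (cardX : #|X| = (k - 2) * t + 2).

Definition uncovered (x y z : X) : bool :=
  [&& x != y, y != z, z != x & [forall b in B, ~~ [&& x \in b, y \in b & z \in b]]].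
Definition degree (x : X) : nat := #|[set b in B | x \in b]|.
Definition codegree (x y : X) : nat := #|[set b in B | (x \in b) && (y \in b)]|.
(** Off the diagonal the subtraction is exact by [codegree_le]; the factor removes the diagonal,
    where [codegree x x] is the degree. *)
Definition defect (x y : X) : nat := (x != y) * (t - codegree x y).
Definition deficient : rel X := fun x y => 0 < defect x y.
Local Notation nb x := [set y | deficient x y].

Lemma uncovered_rot x y z : uncovered x y z -> uncovered y z x.
Proof.
case/and4P=> xy yz zx /forall_inP cov; apply/and4P; split=> //.
by apply/forall_inP => b /cov; do 3!case: (_ \in b).
Qed.

Lemma codegreeC x y : codegree x y = codegree y x.
Proof. by apply: eq_card => b; rewrite !inE [(x \in b) && _]andbC. Qed.

Lemma deficient_sym : symmetric deficient.
Proof. by move=> x y; rewrite /deficient /defect codegreeC eq_sym. Qed.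

Lemma deficient_irr : irreflexive deficient.
Proof. by move=> x; rewrite /deficient /defect eqxx. Qed.

Lemma card_block b : b \in B -> #|b| = k.
Proof. by case/andP: packB => /forall_inP H _ /H/eqP. Qed.

Lemma block_unique x y z b c : x != y -> y != z -> z != x -> b \in B -> c \in B ->
  [&& x \in b, y \in b & z \in b] -> [&& x \in c, y \in c & z \in c] -> b = c.
Proof.
case/andP: packB => _ /forallP /(_ [set x; y; z]) + xy yz zx bB cB bxyz cxyz.
have -> : #|[set x; y; z]| == 3.
  by rewrite setUC cardsU1 cards2 xy !inE negb_or zx [z == y]eq_sym yz.
move/card_le1_eqP; apply; rewrite inE ?bB ?cB; apply/subsetP => w; rewrite !inE -orbA.
  by case/and3P: cxyz => ? ? ?; case/or3P => /eqP->.
by case/and3P: bxyz => ? ? ?; case/or3P => /eqP->.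
Qed.

(** Each of the [(k - 2) * t] other points either lies in exactly one block through [x] and [y] or
    completes an uncovered triple; each such block contains [k - 2] of them. *)
Lemma codegree_uncovered x y : x != y ->
  codegree x y * (k - 2) + #|[set z | uncovered x y z]| = (k - 2) * t.
Proof.
move=> xy; pose D z := (y != z) && (z != x).
have sumD (b : {set X}) : x \in b -> y \in b -> \sum_(z | D z) (z \in b : nat) = #|b| - 2.
  move=> xb yb; rewrite -big_mkcondr sum1_card.
  rewrite (cardsD1 x b) xb (cardsD1 y (b :\ x)) !inE eq_sym xy yb /= subn2 /=.
  by apply: eq_card => z; rewrite !inE unfold_in /= /D eq_sym andbA.
have one z : D z -> \sum_(b in B | (x \in b) && (y \in b)) (z \in b : nat) + uncovered x y z = 1.
  case/andP=> yz zx; rewrite /uncovered xy yz zx /= -big_mkcondr /=.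
  case: (boolP [forall b in B, _]) => [/forall_inP nocov|].
    rewrite big_pred0 // => b; case bB : (b \in B) => //=.
    by rewrite -andbA (negbTE (nocov b bB)).
  rewrite negb_forall => /existsP[b]; rewrite negb_imply negbK => /andP[bB bxyz].
  rewrite (big_pred1 b) // => c /=; apply/idP/eqP => [/andP[/andP[cB cxy] cz]|->];
    last by rewrite bB; case/and3P: bxyz => -> -> ->.
  by apply: (block_unique xy yz zx) => //; rewrite andbA cxy.
have -> : (k - 2) * t = \sum_(z | D z) 1.
  rewrite sum1_card; apply/eqP; rewrite -(eqn_add2r 2) -cardX; apply/eqP.
  rewrite -cardsT (cardsD1 x) (cardsD1 y) !inE eq_sym xy addnA addnC; congr (_ + _).
  by apply: eq_card => z; rewrite !inE unfold_in /= /D eq_sym andbT.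
rewrite -(eq_bigr _ one) big_split /= exchange_big /=; congr (_ + _); last first.
  rewrite -sum1_card -big_mkcondr /=; apply: eq_bigl => z; rewrite inE /D /uncovered.
  by rewrite xy /=; case: (y != z); case: (z != x).
rewrite /codegree -sum_nat_const; apply: eq_big => b; first by rewrite inE.
by rewrite inE => /andP[bB /andP[xb yb]]; rewrite sumD // card_block.
Qed.

Lemma sum_codegree x : \sum_(y | x != y) codegree x y = degree x * (k - 1).
Proof.
under eq_bigr do rewrite /codegree -sum1_card.
rewrite (exchange_big_dep [in [set b in B | x \in b]]) /=; last first.
  by move=> y b _; rewrite !inE andbA => /andP[].
rewrite -sum_nat_const; apply: eq_bigr => b; rewrite inE => /andP[bB xb].
rewrite -(card_block bB) (cardsD1 x b) xb add1n subn1 /= -sum1_card.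
by apply: eq_bigl => y; rewrite !inE bB xb eq_sym.
Qed.

Lemma card_uncovered x y : x != y -> #|[set z | uncovered x y z]| = (k - 2) * defect x y.
Proof.
move=> xy; rewrite /defect xy mul1n mulnBr -(codegree_uncovered xy).
by rewrite [codegree x y * _]mulnC addKn.
Qed.

Lemma codegree_le x y : x != y -> codegree x y <= t.
Proof. move=> /codegree_uncovered; nia. Qed.

Lemma sum_defect x : \sum_y defect x y + degree x * (k - 1) = (#|X| - 1) * t.
Proof.
rewrite -sum_codegree (bigID (fun y => x != y)) /=.
have -> : \sum_(y | ~~ (x != y)) defect x y = 0; last rewrite addn0.
  by apply: big1 => y; rewrite negbK /defect => /eqP->; rewrite eqxx.
rewrite -big_split /= (eq_bigr (fun=> t)); last first.
  by move=> y xy; rewrite /defect xy mul1n subnK // codegree_le.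
rewrite sum_nat_const; congr (_ * _); rewrite -cardsT (cardsD1 x) inE /= add1n subn1 /=.
by apply: eq_card => y; rewrite !inE unfold_in /= eq_sym andbT.
Qed.

Lemma uncovered_deficient x y z : uncovered x y z -> deficient x y.
Proof.
move=> u; have /and4P[xy _ _ _] := u; rewrite /deficient.
have : 0 < #|[set z | uncovered x y z]| by apply/card_gt0P; exists z; rewrite inE.
by rewrite card_uncovered // muln_gt0 => /andP[].
Qed.

(** All three pairs of an uncovered triple are deficient. This supplies the common neighbours that
    [small_component] asks for. *)
Lemma link_sub x y : [set z | uncovered x y z] \subset nb x :&: nb y.
Proof.
apply/subsetP=> z; rewrite !inE => u; rewrite (uncovered_deficient (uncovered_rot u)).
by rewrite deficient_sym (uncovered_deficient (uncovered_rot (uncovered_rot u))).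
Qed.

Lemma deficient_neq x y : deficient x y -> x != y.
Proof. by rewrite /deficient /defect; case: eqP. Qed.

Lemma card_common x y : deficient x y -> (k - 2) * defect x y <= #|nb x :&: nb y|.
Proof. by move=> /deficient_neq xy; rewrite -card_uncovered // subset_leq_card // link_sub. Qed.

Lemma card_nb_le x : #|nb x| <= \sum_y defect x y.
Proof.
rewrite -sum1_card big_mkcond; apply: leq_sum => y _; rewrite inE.
by rewrite /deficient; case: (defect x y).
Qed.

(** Besides [y] itself, the at least [(k - 2) * defect x y] common neighbours each contribute at
    least 1 to the sum. *)
Lemma defect_add_link x y : deficient x y -> (k - 1) * defect x y <= \sum_z defect x z.
Proof.
move=> xy; rewrite (bigD1 y) //=.
suff : (k - 2) * defect x y <= \sum_(z | z != y) defect x z by nia.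
apply: leq_trans (card_common xy) _; rewrite -sum1_card big_mkcond [leqRHS]big_mkcond.
apply: leq_sum => z _; rewrite !inE; case: (boolP (_ && _)) => // /andP[xz yz].
by rewrite eq_sym (deficient_neq yz).
Qed.

(** * Degrees and their shortfall from [R - 1] *)

Variable R : nat.
Hypothesis defR : (#|X| - 1) * t = R * (k - 1) + 2.

(** If [degree x >= R], the defects at [x] sum to at most 2. A deficient pair would force at least
    [k - 1]; without one the sum is 0, contradicting the remainder 2 modulo [k - 1]. *)
Lemma degree_lt x : degree x < R.
Proof.
have := sum_defect x; rewrite defR => sd.
rewrite ltnNge; apply/negP => Rd.
have : R * (k - 1) <= degree x * (k - 1) by rewrite leq_mul2r Rd orbT.
have [y xy|none] := pickP (deficient x).
  have := leq_trans (leq_pmulr (k - 1) xy) (defect_add_link xy); lia.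
move: sd; rewrite big1 => [|y _].
  by rewrite -(subnKC Rd) mulnDl add0n => /addnI; case: (_ - R) => [|j]; nia.
by have := none y; rewrite /deficient; case: defect.
Qed.

(** The subtraction is exact by [degree_lt]. *)
Definition shortfall (x : X) : nat := R.-1 - degree x.

Lemma sum_defect_shortfall x : \sum_y defect x y = k + 1 + shortfall x * (k - 1).
Proof. have := sum_defect x; have := degree_lt x; rewrite defR /shortfall; nia. Qed.

Lemma defect_good x y : shortfall x = 0 -> deficient x y -> defect x y = 1.
Proof.
move=> ex0 xy; have := defect_add_link xy; rewrite sum_defect_shortfall ex0.
move: xy; rewrite /deficient; nia.
Qed.

Lemma card_nb_good x : shortfall x = 0 -> #|nb x| = k.+1.
Proof.
move=> ex0; have := sum_defect_shortfall x; rewrite ex0 addn0 addn1 => <-.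
rewrite -sum1_card big_mkcond; apply: eq_bigr => y _; rewrite inE.
case: (boolP (deficient x y)) => [/(defect_good ex0)->//|].
by rewrite /deficient; case: defect.
Qed.

(** The middle point [y] is asked to have shortfall 0, hence exactly [k + 1] neighbours, so that the
    balls counted in [card_le_sum_shortfall] grow only linearly with [shortfall b]. *)
Lemma exists_shortfall_near x : k %% 6 = 0 ->
  exists b, 0 < shortfall b /\
    [|| x == b, deficient x b | [exists y, [&& shortfall y == 0, deficient x y & deficient y b]]].
Proof.
move=> k6.
have [b /andP[bad near]|none] := pickP (fun b => (0 < shortfall b) &&
   [|| x == b, deficient x b | [exists y, [&& shortfall y == 0, deficient x y & deficient y b]]]);
  first by exists b.
exfalso.
have good0 : shortfall x = 0 by have := none x; rewrite eqxx andbT; case: shortfall.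
have good1 y : deficient x y -> shortfall y = 0.
  by move=> xy; have := none y; rewrite xy orbT andbT; case: shortfall.
have good2 y z : deficient x y -> deficient y z -> shortfall z = 0.
  move=> xy yz; have := none z; rewrite (_ : [exists y, _]) ?orbT ?andbT; first by case: shortfall.
  by apply/existsP; exists y; rewrite xy yz good1.
have comm y z : deficient y z -> k - 2 <= #|nb y :&: nb z|.
  by move=> yz; apply: leq_trans (card_common yz); move: yz; rewrite /deficient; nia.
have := @small_component _ _ deficient_sym deficient_irr k x k_ge12 comm.
set C := _ :|: _ => small.
have goodC y : y \in C -> shortfall y = 0.
  rewrite !inE -orbA => /or3P[/eqP->//|/good1//|/andP[_ /existsP[z /andP[xz]]]]; exact: good2.
have [|Ccl cardC] := small; first by move=> y /goodC /card_nb_good.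
have even := even_degree_sum deficient_sym deficient_irr Ccl
  (fun y yC => card_nb_good (goodC y yC)).
have := @dvdn3_triple_sum _ _ C uncovered_rot
  (fun x y z u => deficient_neq (uncovered_deficient u)).
rewrite (eq_bigr (fun=> (k - 2) * (k + 1))); last first.
  move=> y /goodC gy; have := sum_defect_shortfall y; rewrite gy addn0 => <-.
  rewrite big_distrr /=; apply: eq_bigr => z _.
  have [<-|/card_uncovered//] := eqVneq y z.
  by rewrite /defect eqxx muln0; apply/eqP;
    rewrite cards_eq0; apply/eqP/setP=> w; rewrite !inE /uncovered eqxx.
rewrite sum_nat_const => div3.
have {}div3 : 3 %| #|C| * ((k - 2) * (k + 1)).
  apply: div3 => y z w yC u; apply: (subsetP (Ccl y yC)); rewrite inE.
  exact: uncovered_deficient u.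
have [j kj] : exists j, k = 6 * j by exists (k %/ 6); rewrite {1}(divn_eq k 6) k6 addn0 mulnC.
(* As [6 %| k], 3 is coprime to [(k - 2) * (k + 1)] and 2 to [k + 1]; so [6 %| #|C|], but no
   multiple of 6 lies between [k + 2] and [k + 5]. *)
move: div3 even cardC; rewrite Gauss_dvdl; last first.
  rewrite prime_coprime // Euclid_dvdM //; lia.
rewrite Gauss_dvdl; last by rewrite prime_coprime //; lia.
lia.
Qed.

Lemma card_le_sum_shortfall : k %% 6 = 0 -> #|X| <= 3 * k ^ 2 * \sum_x shortfall x.
Proof.
move=> k6; pose S b := b |: nb b :|: \bigcup_(y in nb b | shortfall y == 0) nb y.
have cover : [set: X] \subset \bigcup_(b | 0 < shortfall b) S b.
  apply/subsetP=> x _; have [b [bad near]] := exists_shortfall_near x k6.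
  apply/bigcupP; exists b => //; rewrite !inE -orbA.
  case/or3P: near => [->//|bx|/existsP[y /and3P[ey xy yb]]]; first by rewrite deficient_sym bx orbT.
  apply/orP; right; apply/orP; right; apply/bigcupP; exists y; last by rewrite inE deficient_sym.
  by rewrite inE ey deficient_sym yb.
have cardU (I : finType) (P : pred I) (F : I -> {set X}) :
    #|\bigcup_(i | P i) F i| <= \sum_(i | P i) #|F i|.
  elim/big_rec2: _ => [|i n A _ IH]; first by rewrite cards0.
  by have [+ _] := leq_card_setU (F i) A; lia.
rewrite -cardsT; apply: leq_trans (subset_leq_card cover) _; apply: leq_trans (cardU _ _ _) _.
rewrite big_distrr /= big_mkcond; apply: leq_sum => b _; case: ifP => // bad.
have nbb : #|nb b| <= k + 1 + shortfall b * (k - 1) by rewrite -sum_defect_shortfall card_nb_le.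
have two : #|\bigcup_(y in nb b | shortfall y == 0) nb y| <= #|nb b| * k.+1.
  apply: leq_trans (cardU _ _ _) _; rewrite -sum_nat_const big_mkcondr /=.
  by apply: leq_sum => y _; case: eqP => // /card_nb_good ->.
have [+ _] := leq_card_setU (b |: nb b) (\bigcup_(y in nb b | shortfall y == 0) nb y).
rewrite -/(S b) cardsU1 inE deficient_irr /= => cS.
apply: leq_trans cS _.
(* Since [shortfall b >= 1], the term [k + 1] is absorbed. With [m] neighbours and shortfall [e],
   the ball has at most [1 + m (k + 2) <= 2 k^2 e + 4 k e + 1 <= 3 k^2 e] points. *)
have nbb2 : #|nb b| <= 2 * k * shortfall b by apply: leq_trans nbb _; nia.
move: two nbb2 bad; move: #|nb b| (shortfall b) => m e two nbb2 bad.
have : m * (k + 2) <= 2 * k * e * (k + 2) by rewrite leq_mul2r nbb2 orbT.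
have : 12 * (k * e) <= k * (k * e) by rewrite leq_mul2r k_ge12 orbT.
have : 0 < k * e by rewrite muln_gt0 bad; lia.
move: two; nia.
Qed.

Lemma sum_degree : \sum_x degree x = k * #|B|.
Proof.
under eq_bigr do rewrite /degree -sum1_card.
rewrite (exchange_big_dep (mem B)) /=; last by move=> x b _; rewrite inE => /andP[].
rewrite mulnC -sum_nat_const; apply: eq_bigr => b bB; rewrite -(card_block bB) -sum1_card.
by apply: eq_bigl => x; rewrite !inE bB.
Qed.

Lemma card_packing_le q : k %% 6 = 0 -> 3 * k ^ 3 * q <= #|X| ->
  k * (#|B| + q) <= #|X| * R.-1.
Proof.
move=> k6 qX; have sum_eq : k * #|B| + \sum_x shortfall x = #|X| * R.-1.
  rewrite -sum_degree -big_split /= -sum_nat_const; apply: eq_bigr => x _.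
  by rewrite /shortfall; have := degree_lt x; lia.
have : 3 * k ^ 2 * (k * q) <= 3 * k ^ 2 * \sum_x shortfall x.
  apply: leq_trans (card_le_sum_shortfall k6); apply: leq_trans qX; rewrite !expnS; lia.
rewrite leq_pmul2l ?muln_gt0 ?expn_gt0; last by lia.
lia.
Qed.
End Packing.

(** * Translation to the rational floors of the bound *)

Import Order.TTheory GRing.Theory Num.Theory.
Local Open Scope ring_scope.

Theorem theorem17 (n k : nat)
  (n_gt0 : (0 < n)%N) (k_gt0 : (0 < k)%N) (le_kn : (k <= n)%N)
  (k_mod6 : (k = 0 %[mod 6])%N) (k_ge12 : (12 <= k)%N)
  (n_mod : (n - 2 = 0 %[mod k - 2])%N)
  (nn_mod : ((n - 1) * (n - 2) = 2 * (k - 2) %[mod (k - 1) * (k - 2)])%N) :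
  (D3 n k)%:Z <= J3' n k - Num.floor (n%:R / (3 * k%:R ^+ 3) : rat).
Proof.
rewrite mod0n in k_mod6.
have n_ge12 : (12 <= n)%N := leq_trans k_ge12 le_kn.
have n_ge2 : (2 <= n)%N by apply: leq_trans n_ge12.
have k_ge2 : (2 <= k)%N by apply: leq_trans k_ge12.
have [t nt] : exists t, (n - 2 = t * (k - 2))%N.
  by apply/dvdnP; rewrite /dvdn n_mod mod0n.
have t_gt0 : (0 < t)%N.
  by rewrite lt0n; apply/eqP => t0; move: nt; rewrite t0; clear - n_ge12; lia.
have [R defR] : exists R, ((n - 1) * t = R * (k - 1) + 2)%N.
  have ge2 : (2 <= (n - 1) * t)%N.
    by apply: leq_trans (leq_pmulr _ t_gt0); clear - n_ge12; lia.
  have k2_gt0 : (0 < k - 2)%N by clear - k_ge12; lia.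
  (* Cancel the factor [k - 2] from the hypothesis [nn_mod]. *)
  have /eqP : ((n - 1) * t = 2 %[mod k - 1])%N.
    by apply/eqP; rewrite -(eqn_pmul2r k2_gt0) !muln_modl -mulnA -nt nn_mod.
  by rewrite eqn_mod_dvd // => /dvdnP[R e]; exists R; rewrite -e subnK.
have cardI : #|'I_n| = ((k - 2) * t + 2)%N.
  by rewrite card_ord mulnC -nt subnK //.
have defR' : ((#|'I_n| - 1) * t = R * (k - 1) + 2)%N by rewrite card_ord.
have pack0 : packing3 k (set0 : {set {set 'I_n}}).
  apply/andP; split; first by apply/forall_inP => b; rewrite inE.
  apply/forall_inP => S _; rewrite (_ : [set b in _ | _] = set0) ?cards0 //.
  by apply/setP => b; rewrite !inE.
(* The empty packing already has degrees below [R]. *)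
have R_gt0 : (0 < R)%N.
  apply: leq_ltn_trans (degree_lt pack0 k_ge12 cardI defR' (Ordinal n_gt0)) => //.
pose K : rat := k%:R; pose N : rat := n%:R.
have K_gt0 : 0 < K by rewrite ltr0n.
have K_ge12 : 12 <= K by rewrite ler_nat.
have eqR : (N - 1) * t%:R = R%:R * (K - 1) + 2.
  have -> : N - 1 = (n - 1)%:R by rewrite natrB.
  have -> : K - 1 = (k - 1)%:R by rewrite natrB.
  by rewrite -!natrM defR natrD.
have eqN : N - 2 = t%:R * (K - 2).
  have -> : N - 2 = (n - 2)%:R by rewrite natrB.
  have -> : K - 2 = (k - 2)%:R by rewrite natrB.
  by rewrite nt natrM.
(* The quotient equals [R + 2 / (K - 1)], and [2 < K - 1]. *)
have floorR : Num.floor ((N - 1) * (N - 2) / ((K - 1) * (K - 2))) = R%:Z.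
  rewrite eqN mulrA eqR -mulf_div divff ?mulr1; last by rewrite lt0r_neq0 //; lra.
  apply: floor_def; rewrite intrD ler_pdivlMr ?ltr_pdivrMr -?pmulrn; [|lra..].
  by apply/andP; split; lra.
have KV_gt0 : 0 < 3 * K ^+ 3 by rewrite mulr_gt0 // exprn_gt0.
rewrite /J3' -/K -/N floorR; set q := Num.floor (_ / (3 * _)).
have q_ge0 : 0 <= q by rewrite floor_ge0 divr_ge0 // ltW.
have qN : q%:~R * (3 * K ^+ 3) <= N by rewrite -ler_pdivlMr // -floor_ge_int.
move: q q_ge0 qN => [q|//] _ qN.
have {}qN : (3 * k ^ 3 * q <= #|'I_n|)%N.
  by rewrite card_ord -(ler_nat rat) 2!natrM natrX mulrC.
have bound (B : {set {set 'I_n}}) : packing3 k B ->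
    #|B|%:Z + q%:Z <= Num.floor (N / K * (R%:Z%:~R - 1)).
  move=> packB; rewrite floor_ge_int -PoszD -pmulrn mulrAC ler_pdivlMr //.
  have := card_packing_le packB k_ge12 cardI defR' k_mod6 qN.
  by rewrite card_ord -(ler_nat rat) !natrM mulrC -subn1 natrB.
rewrite lerBrDr /D3.
(* The default value 0 of the maximum is the size of the empty packing, so [bound] covers it too. *)
elim/big_ind: _ => [|x y Hx Hy|B packB]; last exact: bound.
  by have := bound _ pack0; rewrite cards0.
by case: leqP.
Qed.
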